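(* Let $S$ be a nontrivial numerical semigroup (that is, $S \neq \mathbb{N}$) with multiplicity $m(S)$. Then there is a matrix $A \in \mathrm{M}_{m(S)}(\mathbb{Q})$ such that $\mathcal{S}(A) = S$. Thus, $\dim_{\mathrm{mat}} S \leq m(S)$.
   Context: $\mathbb{N} = \{0,1,2,\ldots\}$. $\mathrm{M}_d(\mathbb{Z})$ and $\mathrm{M}_d(\mathbb{Q})$ denote the sets of $d \times d$ matrices with entries in $\mathbb{Z}$ and $\mathbb{Q}$, respectively. For $A \in \mathrm{M}_d(\mathbb{Q})$, the exponent semigroup of $A$ is $\mathcal{S}(A) = \{ n \in \mathbb{N} : A^n \in \mathrm{M}_d(\mathbb{Z})\}$ (with $A^0 = I$). A numerical semigroup is an additive subsemigroup $S$ of $\mathbb{N}$, containing $0$, with finite complement $\mathbb{N} \setminus S$; it is nontrivial if $S \neq \mathbb{N}$. The multiplicity $m(S)$ is the smallest positive element of $S$ (equivalently, its least minimal generator). The matricial dimension of $S$ is $\dim_{\mathrm{mat}} S = \min\{ d \geq 1 : \text{there is an } A \in \mathrm{M}_d(\mathbb{Q}) \text{ such that } S = \mathcal{S}(A)\}$; it is known that every numerical semigroup is an exponent semigroup of some rational matrix, so this minimum exists. *)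

(* Defs.v *)
From mathcomp Require Import all_boot all_order all_algebra.
From mathcomp Require Import boolp classical_sets cardinality.

Set Implicit Arguments.
Unset Strict Implicit.
Unset Printing Implicit Defensive.

Import Order.TTheory GRing.Theory Num.Theory.
Local Open Scope classical_set_scope.
Local Open Scope ring_scope.

Definition numerical_semigroup (S : set nat) : Prop :=
  [/\ S 0%N,
      forall m n : nat, S m -> S n -> S (m + n)%N
    & finite_set (~` S)].

(* For square matrices of any size [^+] is the matrix power, so A ^+ 0 is the
   identity matrix. *)
Definition exponent_semigroup (d : nat) (A : 'M[rat]_d) : set nat :=
  [set n | A ^+ n \is a mxOver Num.int].

(* The value is 0 if P is empty, and the minimum of P otherwise: see
   [nat_minP]. *)
Definition nat_min (P : set nat) : nat := xget 0%N (P `&` lbound P).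

Lemma nat_minP (P : set nat) : P !=set0 ->
  P (nat_min P) /\ forall n : nat, P n -> (nat_min P <= n)%N.
Proof.
move=> [k Pk].
have exP : exists n, `[< P n >] by exists k; exact/asboolP.
case: (ex_minnP exP) => m /asboolP Pm m_min.
have [] : (P `&` lbound P) (nat_min P).
  rewrite /nat_min; apply: (@xgetPex _ 0%N); exists m; split=> // n Pn.
  by rewrite leEnat; apply/m_min/asboolP.
by move=> Pmin lbmin; split=> // n /lbmin; rewrite leEnat.
Qed.

Definition multiplicity (S : set nat) : nat :=
  nat_min [set n | S n /\ (0 < n)%N].

Definition matricial_dimension (S : set nat) : nat :=
  nat_min [set d | (1 <= d)%N /\
                   exists A : 'M[rat]_d, S = exponent_semigroup A].

(* Main.v *)
(* Let m be the multiplicity of S, w(x) the least element of S congruent to x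
   modulo m, and f(x) = (x - w(x)) / m, an integer with f(x) >= 0 iff x \in S.
   Take for A the cyclic shift of Z/m weighted by 2^(f(i+1) - f(i)). The weights
   telescope: A^n maps e_i to 2^(f(i+n) - f(i)) e_(i+n). Since
   w(i+n) <= w(i) + n for n in S, these exponents are nonnegative when n is in
   S; conversely, i = 0 gives the exponent f(n), negative when n is not in S. *)
Require Import Defs.
From mathcomp Require Import all_boot all_order all_algebra.
From mathcomp Require Import boolp classical_sets cardinality.
From mathcomp Require Import zify ring.
Import Order.TTheory GRing.Theory Num.Theory.
Local Open Scope classical_set_scope.
Local Open Scope ring_scope.

(** [F] lives on [nat], not on residues: the wrap-around entry in the last row is [F m / F m.-1],
    not [F 0 / F m.-1]. *)
Definition weighted_cycle (m : nat) (F : nat -> rat) : 'M[rat]_m :=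
  \matrix_(i, j) (F i.+1 / F i *+ (j == i.+1 %% m :> nat)%N).

(** By quasi-periodicity [F x.+1 / F x] depends only on [x %% m], so the row reached after [n] steps
    contributes [F (i + n).+1 / F (i + n)], and the product telescopes across wrap-arounds too. *)
Lemma weighted_cycleX (m : nat) (F : nat -> rat) (c : rat) (n : nat) :
    (forall x, F x != 0) -> (forall x, F (x + m)%N = c * F x) ->
  forall i j : 'I_m,
  (weighted_cycle m F ^+ n) i j =
    F (i + n)%N / F i *+ (j == (i + n) %% m :> nat)%N.
Proof.
move=> F0 Fm i; have Fmq q x : F (q * m + x)%N = c ^+ q * F x.
  elim: q => [|q IHq]; first by rewrite mul1r.
  by rewrite mulSn -addnA addnC Fm IHq exprS mulrA.
have m_gt0 : (0 < m)%N by apply: leq_trans (ltn_ord i).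
elim: n => [|n IHn] j.
  by rewrite expr0 -[1]/(1%:M) mxE addn0 divff // modn_small // eq_sym.
rewrite exprSr -[_ * _]/(_ *m _) mxE.
(* Column [k] carries the only nonzero entry of row [i] of the [n]-th power. *)
pose k := Ordinal (ltn_pmod (i + n) m_gt0).
rewrite (bigD1 k) //= big1 ?addr0 => [|l lk]; last first.
  by rewrite IHn -[(l == _ :> nat)]/(l == k) (negbTE lk) mulr0n mul0r.
have -> : ((i + n.+1) %% m = ((i + n) %% m).+1 %% m)%N.
  by rewrite -[in RHS]addn1 modnDml addn1 addnS.
rewrite IHn eqxx mulr1n mxE /= mulrnAr.
congr (_ *+ _).
have := Fmq ((i + n) %/ m)%N ((i + n) %% m).+1.
have := Fmq ((i + n) %/ m)%N ((i + n) %% m)%N.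
rewrite !addnS -divn_eq => -> ->.
by field; rewrite !F0.
Qed.

Definition apery (S : set nat) (m x : nat) : nat :=
  nat_min [set w | S w /\ w = x %[mod m]].

(** This is 2^(f(x)): [x] and its Apéry element have the same remainder modulo [m], so f(x) is the
    difference of their quotients. A ratio of two natural powers accommodates f(x) < 0. *)
Definition apery_weight (S : set nat) (m x : nat) : rat :=
  2 ^+ (x %/ m) / 2 ^+ (apery S m x %/ m).

Section NumericalSemigroup.

Variables (S : set nat) (m : nat).
Hypothesis hS : numerical_semigroup S.

Lemma numerical_semigroup_cofinite : exists N, forall n, (N <= n)%N -> S n.
Proof.
have [_ _ /finite_seqP[s sE]] := hS.
exists (\max_(x <- s) x).+1 => n n_big; apply: contrapT => nS.
have : n \in s by have : [set` s] n by rewrite -sE.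
by move=> n_s; have := @leq_bigmax_seq _ s xpredT id n n_s isT;
  rewrite leqNgt n_big.
Qed.

Lemma multiplicityP : S (multiplicity S) /\ (0 < multiplicity S)%N.
Proof.
have [N NS] := numerical_semigroup_cofinite.
suff [] : [set n | S n /\ (0 < n)%N] (multiplicity S) by [].
by apply: (nat_minP _).1; exists N.+1; split=> //; apply: NS.
Qed.

Hypothesis m_gt0 : (0 < m)%N.

Lemma aperyP (x : nat) : [/\ S (apery S m x), apery S m x = x %[mod m]
  & forall w, S w -> w = x %[mod m] -> (apery S m x <= w)%N].
Proof.
have [N NS] := numerical_semigroup_cofinite.
have [|[Sa ax] a_min] := @nat_minP [set w | S w /\ w = x %[mod m]].
  (* Since [m > 0], this witness is at least [N], hence in [S]. *)
  exists (N * m + x)%N; split; last exact: modnMDl.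
  by apply: NS; rewrite -{1}[N]muln1 -[leqLHS]addn0 leq_add // leq_mul.
by split=> // w Sw wx; apply: a_min.
Qed.

Lemma apery_eqmod (x y : nat) : x = y %[mod m] -> apery S m x = apery S m y.
Proof. by rewrite /apery => ->. Qed.

Lemma apery_weight_neq0 (x : nat) : apery_weight S m x != 0.
Proof. by rewrite mulf_neq0 ?invr_eq0 ?expf_neq0. Qed.

Lemma apery_weightDm (x : nat) :
  apery_weight S m (x + m)%N = 2 * apery_weight S m x.
Proof.
rewrite /apery_weight (@apery_eqmod (x + m)%N x) ?modnDr //.
by rewrite divnDr // divnn m_gt0 addn1 exprS mulrA.
Qed.

Lemma apery_weight0 : apery_weight S m 0 = 1.
Proof.
have [S0 _ _] := hS; have [_ _ /(_ 0%N S0 erefl)] := aperyP 0.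
by rewrite leqn0 /apery_weight => /eqP ->; rewrite div0n divff.
Qed.

Lemma apery_weight_ratio_int (x n : nat) :
  S n -> apery_weight S m (x + n) / apery_weight S m x \is a Num.int.
Proof.
have [_ SD _] := hS; move=> Sn.
have [Sa ax _] := aperyP x; have [_ bx b_min] := aperyP (x + n).
have ab : (apery S m (x + n) <= apery S m x + n)%N.
  by apply: b_min; [exact: SD | rewrite -modnDml ax modnDml].
(* After multiplication by [m] the remainders cancel: by [ax] and [bx] each Apéry element shares its
   remainder with [x] or [x + n], so [ab] passes to quotients. *)
have le : (apery S m (x + n) %/ m + x %/ m <= (x + n) %/ m + apery S m x %/ m)%N.
  rewrite -(leq_pmul2r m_gt0) !mulnDl.
  move: ab (divn_eq x m) (divn_eq (x + n) m) (divn_eq (apery S m x) m)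
    (divn_eq (apery S m (x + n)) m); rewrite ax bx; lia.
rewrite /apery_weight; move: le.
set p := ((x + n) %/ m)%N; set q := (x %/ m)%N.
set a := (apery S m (x + n) %/ m)%N; set b := (apery S m x %/ m)%N => le.
(* By [le] the truncated subtraction in the exponent is exact. *)
suff -> : 2 ^+ p / 2 ^+ a / (2 ^+ q / 2 ^+ b) = 2 ^+ (p + b - (a + q)) :> rat.
  by rewrite rpredX.
by rewrite expfB_cond // !exprD; field; rewrite !expf_neq0.
Qed.

(** If [n] is at least its Apéry element, it exceeds it by a multiple of [m], which lies in [S].
    Otherwise the weight lies strictly between 0 and 1, where there is no integer. *)
Lemma apery_weight_int (n : nat) :
  S m -> apery_weight S m n \is a Num.int -> S n.
Proof.
have [S0 SD _] := hS; move=> Sm.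
have [Sa an _] := aperyP n.
have SMm q : S (q * m)%N by elim: q => // q IHq; rewrite mulSn; apply: SD.
have [le_an _|lt_na] := leqP (apery S m n) n.
  suff -> : n = (apery S m n + (n %/ m - apery S m n %/ m) * m)%N by apply: SD.
  have := leq_div2r m le_an; rewrite -(leq_pmul2r m_gt0) mulnBl.
  by move: an (divn_eq n m) (divn_eq (apery S m n) m) => ->; lia.
have lt_div : (n %/ m < apery S m n %/ m)%N.
  rewrite -(ltn_pmul2r m_gt0).
  by move: an (divn_eq n m) (divn_eq (apery S m n) m) => ->; lia.
have gt0 : 0 < apery_weight S m n by rewrite divr_gt0 ?exprn_gt0.
have lt1 : apery_weight S m n < 1.
  by rewrite /apery_weight ltr_pdivrMr ?exprn_gt0 // mul1r ltr_eXn2l.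
move=> /intrP[z zE]; move: gt0 lt1; rewrite zE ltr0z -[1]/(1%:~R) ltr_int; lia.
Qed.

End NumericalSemigroup.

Theorem theorem1p1 (S : set nat) (hS : numerical_semigroup S)
    (hnontrivial : S <> [set: nat]) :
  (exists A : 'M[rat]_(multiplicity S), exponent_semigroup A = S) /\
  (matricial_dimension S <= multiplicity S)%N.
Proof.
have [Sm m_gt0] := multiplicityP _ hS; set m := multiplicity S in Sm m_gt0 *.
suff [A AE] : exists A : 'M[rat]_m, exponent_semigroup A = S.
  split; first by exists A.
  pose D := [set d | (1 <= d)%N /\ exists A : 'M[rat]_d, S = exponent_semigroup A].
  have Dm : D m by split=> //; exists A.
  by apply: (nat_minP (ex_intro _ m Dm)).2.
pose F := apery_weight S m.
have AX n i j := weighted_cycleX m F 2 n (apery_weight_neq0 S m)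
  (apery_weightDm S m m_gt0) i j.
exists (weighted_cycle m F); apply/seteqP; split=> n /=.
  (* The entry in row 0 and column [n %% m] is [F n / F 0], and [F 0 = 1]. *)
  move=> /mxOverP /(_ (Ordinal m_gt0) (Ordinal (ltn_pmod n m_gt0))).
  rewrite AX /= add0n eqxx mulr1n {2}/F apery_weight0 // divr1.
  exact: apery_weight_int.
move=> Sn; apply/mxOverP => i j; rewrite AX rpredMn //.
exact: apery_weight_ratio_int.
Qed.
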